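(* Let $\sigma$ be a modal signature and let $M_a$ and $N_b$ be finite $\sigma$-LTSs. Then $M_a$ and $N_b$ satisfy exactly the same formulas of $\mathrm{ML}^{+,G}_\Diamond$ over $\sigma$ if and only if $\hom_{\mathbb{B}}(\mathcal{F}_\sigma, M_a) = \hom_{\mathbb{B}}(\mathcal{F}_\sigma, N_b)$.
   Context: A modal signature is $\sigma = \mathrm{Prop} \cup \mathbb{A}$, where $\mathrm{Prop}$ is a finite set of unary relation symbols (proposition letters) and $\mathbb{A} = \{R_i \mid i \in I\}$ ($I$ finite) is a finite set of binary relation symbols (actions). A $\sigma$-LTS $M_a$ is a $\sigma$-structure $M$ with one distinguished element $a$. A homomorphism $h: T_c \to M_a$ is a map with $h(c)=a$ preserving all unary and binary facts. $\hom_{\mathbb{B}}(T_c,M_a)$ (Boolean semiring) is $1$ if a homomorphism exists and $0$ otherwise; for a class $\mathcal{C}$ of finite $\sigma$-LTSs, $\hom_{\mathbb{B}}(\mathcal{C},M_a)$ is the $\mathcal{C}$-indexed family of these values, and equality means agreement at every member. A directed $\sigma$-path from $m$ to $n$ is a sequence $m=b_0,\dots,b_\ell=n$ with $R(b_j,b_{j+1})$ for some $R\in\mathbb{A}$ for each $j<\ell$. A $\sigma$-tree is a $\sigma$-LTS in which every state is reached from the distinguished element by a unique directed $\sigma$-path. A $\sigma$-forest is a $\sigma$-LTS obtained as the disjoint union of finitely many $\sigma$-trees, with distinguished element the root of one of them; $\mathcal{F}_\sigma$ is the class of finite $\sigma$-forests. $\mathrm{ML}^{+,G}_\Diamond$ has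 formulas $\varphi ::= p \mid \varphi\land\varphi\mid\varphi\lor\varphi\mid\Diamond_i\varphi\mid \mathrm{E}\varphi$ where $M_a\models p$ iff $p^M(a)$, $M_a\models\Diamond_i\varphi$ iff some $b$ with $R_i^M(a,b)$ has $M_b\models\varphi$, and $M_a\models\mathrm{E}\varphi$ iff some $b\in\mathrm{dom}(M)$ has $M_b\models\varphi$.
   Formalization: The formulas also include truth (without it a structure with no true letters satisfies no formula, and the claim fails), and a directed path records the action of each step, so in a tree no two states are related by two different actions (otherwise the claim fails for two or more actions). *)

(* Defs.v *)
From HB Require Import structures.
From mathcomp Require Import all_boot.

Set Implicit Arguments.
Unset Strict Implicit.
Unset Printing Implicit Defensive.

Record modal_signature : Type := ModalSignature {
  letters : finType;
  actions : finType
}.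

Record fin_struct (sigma : modal_signature) : Type := FinStruct {
  dom :> finType;
  val_of : letters sigma -> pred dom;
  rel_of : actions sigma -> rel dom
}.

Record fin_lts (sigma : modal_signature) : Type := FinLTS {
  carrier :> fin_struct sigma;
  point : carrier
}.

Section Defs.

Variable sigma : modal_signature.

Definition is_hom (T M : fin_lts sigma) (h : T -> M) : Prop :=
  [/\ h (point T) = point M,
      forall (p : letters sigma) (x : T), val_of p x -> val_of p (h x)
    & forall (i : actions sigma) (x y : T),
        rel_of i x y -> rel_of i (h x) (h y)].

(* The Boolean semiring is [bool]; since T and M are finite, homomorphisms
   range over the finite type of functions from T to M. *)
Definition homB (T M : fin_lts sigma) : bool :=
  [exists h : {ffun T -> M},
    [&& h (point T) == point M,
        [forall p : letters sigma, forall x : T,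
          val_of p x ==> val_of p (h x)]
      & [forall i : actions sigma, forall x : T, forall y : T,
          rel_of i x y ==> rel_of i (h x) (h y)]]].

Lemma homBP (T M : fin_lts sigma) :
  reflect (exists h : T -> M, is_hom h) (homB T M).
Proof.
apply: (iffP existsP) => [[h /and3P[/eqP h0 /'forall_forallP hv /forallP hr]]|].
  exists h; split=> [//|p x|i x y]; first exact/implyP.
  by move: (hr i) => /'forall_forallP hri; exact/implyP.
move=> [h [h0 hv hr]]; exists (finfun h); rewrite ffunE h0 eqxx /=.
apply/andP; split; first by apply/'forall_forallP=> p x; rewrite ffunE; exact/implyP/hv.
apply/forallP=> i; apply/'forall_forallP=> x y; rewrite !ffunE.
exact/implyP/hr.
Qed.

Definition homB_agree (C : fin_lts sigma -> Prop) (M N : fin_lts sigma) : Prop :=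
  forall T : fin_lts sigma, C T -> homB T M = homB T N.

(* A directed path x = b_0, ..., b_l = y is recorded as the sequence of its
   steps (R_i, b_{j+1}), i.e. together with the action witnessing each step.
   Hence two actions relating the same pair of states give two paths. *)
Fixpoint dpath (M : fin_struct sigma) (x : M) (s : seq (actions sigma * M))
    (y : M) : bool :=
  if s is (i, z) :: s' then rel_of i x z && dpath z s' y else x == y.

Definition is_tree (T : fin_lts sigma) : Prop :=
  forall y : T, exists! s : seq (actions sigma * T), dpath (point T) s y.

Definition disj_union (J : finType) (T : J -> fin_struct sigma) :
    fin_struct sigma :=
  @FinStruct sigma {j : J & T j}
    (fun p u => val_of p (tagged u))
    (fun i u v =>
       (tag u == tag v) && rel_of i (tagged u) (tagged_as u v)).

Definition isomorphic (M N : fin_lts sigma) : Prop :=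
  exists h : M -> N,
    [/\ bijective h,
        h (point M) = point N,
        forall (p : letters sigma) (x : M), val_of p (h x) = val_of p x
      & forall (i : actions sigma) (x y : M),
          rel_of i (h x) (h y) = rel_of i x y].

Definition is_forest (F : fin_lts sigma) : Prop :=
  exists (n : nat) (T : 'I_n -> fin_lts sigma) (k : 'I_n),
    (forall j : 'I_n, is_tree (T j)) /\
    isomorphic F
      (@FinLTS sigma (disj_union (fun j => carrier (T j)))
         (Tagged (fun j => dom (carrier (T j))) (point (T k)))).

(* Truth (the empty conjunction) is a formula: without it no formula holds in
   a structure with no true proposition letter, whatever its transitions. *)
Inductive form : Type :=
  | Top
  | Letter of letters sigma
  | And of form & form
  | Or of form & form
  | Dia of actions sigma & form
  | Ex of form.

Fixpoint sat (M : fin_struct sigma) (x : M) (phi : form) : Prop :=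
  match phi with
  | Top => True
  | Letter p => val_of p x
  | And phi1 phi2 => sat x phi1 /\ sat x phi2
  | Or phi1 phi2 => sat x phi1 \/ sat x phi2
  | Dia i phi1 => exists y : M, rel_of i x y /\ sat y phi1
  | Ex phi1 => exists y : M, sat y phi1
  end.

Definition ml_equiv (M N : fin_lts sigma) : Prop :=
  forall phi : form, sat (point M) phi <-> sat (point N) phi.

End Defs.

(* Main.v *)
Require Import Defs.
From mathcomp Require Import all_boot.

(** The existence of a homomorphism from a forest F is described by a formula: the depth-bounded
    characteristic formula of the distinguished root, together with one global
    diamond per component; conversely a model of that formula simulates each
    tree, and a simulation of a tree is turned into a homomorphism by following
    the unique paths from the root.  In the other direction, the disjoint union
    over all states m of the depth-d unravellings of M at m is a forest mapping
    to M_a; a homomorphism from it to N_b transfers every positive formula of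
    modal depth at most d, global diamonds being witnessed by the roots. *)

Set Implicit Arguments.
Unset Strict Implicit.
Unset Printing Implicit Defensive.

Section Forests.

Variable sigma : modal_signature.
Implicit Types (M N : fin_struct sigma) (T : fin_lts sigma).

Local Notation form := (form sigma).
Local Notation Top := (Top sigma).

(** * Directed paths and their end states *)

Definition path_end M (x : M) (s : seq (actions sigma * M)) : M :=
  last x (unzip2 s).

Lemma path_end_rcons M (x : M) s u : path_end x (rcons s u) = u.2.
Proof. by rewrite /path_end /unzip2 map_rcons last_rcons. Qed.

Lemma dpath_end M (x : M) s y : dpath x s y -> path_end x s = y.
Proof. by elim: s x => [|[i z] s IHs] x /= => [/eqP|/andP[_ /IHs]]. Qed.

Lemma dpath_rcons M (x : M) s u y :
  dpath x (rcons s u) y =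
  [&& dpath x s (path_end x s), rel_of u.1 (path_end x s) u.2 & u.2 == y].
Proof.
elim: s x => [|[i z] s IHs] x /=; first by case: u => i z; rewrite /= eqxx.
by rewrite IHs -andbA.
Qed.

(** * Characteristic formulas *)

Definition Conj (I : finType) (P : pred I) (F : I -> form) : form :=
  foldr (fun i => And (F i)) Top (enum P).

Lemma sat_Conj M (x : M) (I : finType) (P : pred I) (F : I -> form) :
  sat x (Conj P F) <-> (forall i, P i -> sat x (F i)).
Proof.
have memP i : (i \in enum P) = P i by rewrite mem_enum.
suff satE s : sat x (foldr (fun i => And (F i)) Top s) <->
    (forall i, i \in s -> sat x (F i)).
  by apply: (iff_trans (satE _)); split=> xF i; move: (xF i); rewrite memP.
elim: s => [|j s IHs] /=; first by split.
split=> [[xj /IHs xs] i|xs].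
  by rewrite inE => /predU1P[->//|]; apply: xs.
split; first by apply: xs; rewrite mem_head.
by apply/IHs => i si; apply: xs; rewrite inE si orbT.
Qed.

(** A Boolean version, so that satisfaction of a characteristic formula can serve as the simulation
    [Z] from which successors are picked. *)
Fixpoint satb M (x : M) (phi : form) : bool :=
  match phi with
  | Defs.Top => true
  | Letter p => val_of p x
  | And phi1 phi2 => satb x phi1 && satb x phi2
  | Or phi1 phi2 => satb x phi1 || satb x phi2
  | Dia i phi1 => [exists y : M, rel_of i x y && satb y phi1]
  | Ex phi1 => [exists y : M, satb y phi1]
  end.

Lemma satP M (x : M) phi : reflect (sat x phi) (satb x phi).
Proof.
elim: phi x => [|p|f IHf g IHg|f IHf g IHg|i f IHf|f IHf] x /=.
- exact: ReflectT.
- exact: idP.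
- by apply: (iffP andP) => -[/IHf ? /IHg].
- by apply: (iffP orP) => -[/IHf|/IHg]; [left|right|left|right].
- apply: (iffP existsP) => -[y]; first by case/andP=> xy /IHf; exists y.
  by case=> xy /IHf fy; exists y; rewrite xy.
- by apply: (iffP existsP) => -[y /IHf]; exists y.
Qed.

(** The positive half of a Hintikka formula: it holds at [y] iff [y] simulates [x] for [n] steps.
    Only true letters and existing successors are recorded. *)
Fixpoint char_form (n : nat) M (x : M) : form :=
  And (Conj (fun p => val_of p x) (@Letter sigma))
      (if n is n'.+1 then
         Conj (fun u : actions sigma * M => rel_of u.1 x u.2)
              (fun u => Dia u.1 (char_form n' u.2))
       else Top).

Lemma char_form_letter n M (x : M) N (y : N) p :
  sat y (char_form n x) -> val_of p x -> val_of p y.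
Proof. by case: n => [|n] /= [/sat_Conj yx _]; apply: yx. Qed.

Lemma char_form_step n M (x : M) N (y : N) i x' :
  sat y (char_form n.+1 x) -> rel_of i x x' ->
  exists y', rel_of i y y' /\ sat y' (char_form n x').
Proof. by move=> /= [_ /sat_Conj yx] xx'; apply: (yx (i, x')). Qed.

Lemma char_form_hom M N (h : M -> N) :
  (forall p x, val_of p x -> val_of p (h x)) ->
  (forall i x y, rel_of i x y -> rel_of i (h x) (h y)) ->
  forall n x, sat (h x) (char_form n x).
Proof.
move=> hv hr; elim=> [|n IHn] x /=; (split; first by apply/sat_Conj => p; apply: hv).
  by [].
by apply/sat_Conj => -[i y] /= xy; exists (h y); split; [apply: hr|apply: IHn].
Qed.

(** Simulating successors are chosen one by one along the path from the root. As each state has a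
    single path, the choices never conflict. *)
Lemma tree_hom_of_simulation T M (m : M) (Z : T -> M -> bool) :
  is_tree T -> Z (point T) m ->
  (forall p x y, Z x y -> val_of p x -> val_of p y) ->
  (forall i x x' y, Z x y -> rel_of i x x' ->
     exists y', rel_of i y y' && Z x' y') ->
  exists h : T -> M, @is_hom sigma T (FinLTS m) h.
Proof.
move=> treeT Zm Zv Zr.
have exP x : exists s, dpath (point T) s x by have [s []] := treeT x; exists s.
have uniqP x s t : dpath (point T) s x -> dpath (point T) t x -> s = t.
  by have [r [_ r_uniq]] := treeT x => /r_uniq <- /r_uniq.
pose pth x := xchoose (exP x).
have pthP x : dpath (point T) (pth x) x := xchooseP (exP x).
(* The default [y] is never reached from a simulating pair, by [stepP]. *)
pose step (y : M) (u : actions sigma * T) :=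
  odflt y [pick y' | rel_of u.1 y y' && Z u.2 y'].
pose h x := foldl step m (pth x).
have stepP x y i x' : Z x y -> rel_of i x x' ->
    rel_of i y (step y (i, x')) && Z x' (step y (i, x')).
  move=> Zxy xx'; rewrite /step; case: pickP => //= no.
  by have [y'] := Zr _ _ _ _ Zxy xx'; rewrite no.
have Zfold s x : dpath (point T) s x -> Z x (foldl step m s).
  elim/last_ind: s x => [|s [i z] IHs] x; first by move/eqP <-.
  rewrite dpath_rcons foldl_rcons => /and3P[/IHs Zs zr /eqP<-].
  by have /andP[] := stepP _ _ _ _ Zs zr.
exists h; split=> [|p x|i x y xy] /=.
- by rewrite /h (uniqP (point T) (pth _) [::]) /=.
- by apply: Zv; apply: Zfold.
(* By uniqueness the path to [y] is the path to [x] followed by the edge, so [h y] is one step away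
   from [h x]. *)
- have -> : h y = step (h x) (i, y).
    rewrite /h (uniqP y (pth y) (rcons (pth x) (i, y))) ?foldl_rcons //.
    by rewrite dpath_rcons (dpath_end (pthP x)) pthP xy /=.
  by have /andP[] := stepP x (h x) i y (Zfold _ _ (pthP x)) xy.
Qed.

(** The maximal depth of a state of the tree suffices as [n], since every edge raises the depth by
    exactly one. *)
Lemma tree_char_form T : is_tree T ->
  exists n, forall M (m : M), sat m (char_form n (point T)) ->
    exists h : T -> M, @is_hom sigma T (FinLTS m) h.
Proof.
move=> treeT.
have exP x : exists s, dpath (point T) s x by have [s []] := treeT x; exists s.
pose depth x := size (xchoose (exP x)).
have depthP x s : dpath (point T) s x -> depth x = size s.
  have [r [_ r_uniq]] := treeT x.
  by rewrite /depth -(r_uniq _ (xchooseP (exP x))) => /r_uniq <-.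
have depth0 : depth (point T) = 0 by apply: (depthP _ [::]); rewrite /=.
have depthS i x y : rel_of i x y -> depth y = (depth x).+1.
  move=> xy; have px := xchooseP (exP x).
  rewrite (depthP y (rcons (xchoose (exP x)) (i, y))) ?size_rcons //.
  by rewrite dpath_rcons (dpath_end px) px xy /=.
pose n := \max_x depth x.
have depth_le x : depth x <= n by apply: leq_bigmax.
exists n => M m mT.
apply: (@tree_hom_of_simulation T M m
  (* At depth [depth x] there remain [n - depth x] steps to simulate. *)
  (fun x y => satb y (char_form (n - depth x) x))) => //.
- by rewrite depth0 subn0; apply/satP.
- by move=> p x y /satP; apply: char_form_letter.
move=> i x x' y /satP yx xx'.
have lt_x : depth x < n by rewrite -(depthS _ _ _ xx').
move: yx; rewrite -(subnSK lt_x) => /char_form_step /(_ xx') [y' [yy' /satP y'x']].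
by exists y'; rewrite yy' (depthS _ _ _ xx').
Qed.

(** * Homomorphisms out of forests *)

Lemma disj_union_rel (J : finType) (S : J -> fin_struct sigma) i j (x y : S j) :
  @rel_of sigma (disj_union S) i
    (Tagged (fun j => dom (S j)) x) (Tagged (fun j => dom (S j)) y) =
  rel_of i x y.
Proof. by rewrite /= eqxx tagged_asE. Qed.

Lemma isomorphic_homB T T' N : isomorphic T T' ->
  forall n : N, homB T (FinLTS n) = homB T' (FinLTS n).
Proof.
move=> [f [[g fK gK] fp fv fr]] n; apply/homBP/homBP => -[h [hp hv hr]].
  exists (h \o g); split=> [|p x|i x y] /=; first by rewrite -fp fK.
    by rewrite -{1}(gK x) fv; apply: hv.
  by rewrite -{1}(gK x) -{1}(gK y) fr; apply: hr.
exists (h \o f); split=> [|p x|i x y] /=; first by rewrite fp.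
  by rewrite -fv; apply: hv.
by rewrite -fr; apply: hr.
Qed.

(** Components are mapped independently: the root of component [k] must go to [n], whereas the other
    roots may go anywhere, whence [Ex]. *)
Lemma forest_char_form T : is_forest T ->
  exists phi, forall N (n : N), sat n phi <-> homB T (FinLTS n).
Proof.
move=> [r [S [k [treeS isoT]]]].
have /fin_all_exists[d dP] := fun j => tree_char_form (treeS j).
pose chi j := char_form (d j) (point (S j)).
exists (And (chi k) (Conj xpredT (fun j => Ex (chi j)))) => N n.
rewrite (isomorphic_homB isoT); split=> [[nk /sat_Conj nj]|/homBP[h [hp hv hr]]].
  have exh j : exists h : S j -> N,
      [/\ j = k -> h (point (S j)) = n,
          forall p x, val_of p x -> val_of p (h x)
        & forall i x y, rel_of i x y -> rel_of i (h x) (h y)].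
    have [y [y_chi ykn]] : exists y : N, sat y (chi j) /\ (j = k -> y = n).
      have [-> | kj] := eqVneq j k; first by exists n.
      have [//|y yj] := nj j; exists y; split=> // jk.
      by rewrite jk eqxx in kj.
    have [h [hp hv hr]] := dP j N y y_chi.
    by exists h; split=> // jk; rewrite hp /= ykn.
  have /fin_all_exists[h hP] := exh.
  apply/homBP; exists (fun u => h (tag u) (tagged u)); split=> [|p [j x]|i [j x] [l y]] /=.
  - by have [-> ] := hP k.
  - by have [_ hv _] := hP j; apply: hv.
  (* Identifying the two tags puts both states in one component, where [tagged_as] is trivial. *)
  case/andP=> /eqP jl; case: l / jl y => y; rewrite tagged_asE.
  by have [_ _ hr] := hP j; apply: hr.
have sub (j : 'I_r) (x : S j) : sat (h (Tagged (fun j => dom (S j)) x)) (char_form (d j) x).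
  apply: (char_form_hom (h := fun x => h (Tagged (fun j => dom (S j)) x))) => {x}.
    by move=> p x xp; apply: hv.
  by move=> i x y xy; apply: hr; rewrite disj_union_rel.
split; first by move: (sub k (point (S k))); rewrite hp.
by apply/sat_Conj => j _; eexists; apply: sub.
Qed.

(** * Unravellings *)

Section Unravelling.

Variables (M : fin_struct sigma) (d : nat) (m : M).

(** Nodes are paths from [m]; the bound [d] on their length keeps the type finite. *)
Definition unravel_node : finType :=
  {s : d.-bseq (actions sigma * M) | dpath m s (path_end m s)}.

Definition trace (u : unravel_node) : seq (actions sigma * M) := val u.
Definition tip (u : unravel_node) : M := path_end m (trace u).

Lemma trace_inj : injective trace.
Proof. by move=> u v /val_inj/val_inj. Qed.

Lemma trace_surj s :
  size s <= d -> dpath m s (path_end m s) -> exists u, trace u = s.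
Proof. by move=> sd ps; exists (Sub (Bseq sd) ps : unravel_node). Qed.

(** The action is stored in the trace, so two actions between the same states of [M] lead to
    distinct nodes. *)
Definition unravel_struct : fin_struct sigma :=
  @FinStruct sigma unravel_node
    (fun p u => val_of p (tip u))
    (fun i u v => trace v == rcons (trace u) (i, tip v)).

Definition unravel_root : unravel_node :=
  exist _ [bseq] (eqxx m).

Definition unravel : fin_lts sigma :=
  @FinLTS sigma unravel_struct unravel_root.

Lemma unravel_rel_tip i (u v : unravel) :
  rel_of i u v -> rel_of i (tip u) (tip v).
Proof.
move=> /= /eqP tv; have := valP v.
by rewrite -[dpath _ _ _]/(dpath m (trace v) (tip v)) tv dpath_rcons => /and3P[].
Qed.

Lemma unravel_step i (u : unravel) y :
  size (trace u) < d -> rel_of i (tip u) y ->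
  exists v : unravel, [/\ rel_of i u v, tip v = y & size (trace v) = (size (trace u)).+1].
Proof.
move=> ud uy; have [||v tv] := @trace_surj (rcons (trace u) (i, y)).
- by rewrite size_rcons.
- by rewrite path_end_rcons dpath_rcons (valP u) uy eqxx.
by exists v; rewrite /= /tip tv path_end_rcons eqxx size_rcons.
Qed.

(** A node is reached by induction on its trace, removing the last step. Uniqueness holds since the
    trace determines the predecessor and the action of the last edge. *)
Lemma unravel_tree : is_tree unravel.
Proof.
have reach (s : seq (actions sigma * M)) :
    forall u : unravel, trace u = s -> exists t, dpath (point unravel) t u.
  elim/last_ind: s => [|s [i y] IHs] u us.
    by exists [::]; apply/eqP/trace_inj; rewrite us.
  have := valP u; rewrite -[dpath _ _ _]/(dpath m (trace u) (tip u)) us.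
  rewrite dpath_rcons => /and3P[ps _ _].
  have [|w ws] := trace_surj _ ps.
    have := size_bseq (val u); rewrite -[size _]/(size (trace u)) us size_rcons.
    exact: ltnW.
  have [t pt] := IHs w ws; exists (rcons t (i, u)).
  rewrite dpath_rcons (dpath_end pt) pt /= ws us /tip us path_end_rcons /=.
  by rewrite !eqxx.
move=> u; have [t pt] := reach _ u erefl; exists t; split=> // t' pt'.
elim/last_ind: t u t' pt pt' => [|t [i z] IHt] u t'.
  move=> /eqP<-; case/lastP: t' => // t' [i z].
  rewrite dpath_rcons /= => /and3P[_ /eqP + /eqP zu].
  by rewrite zu => /(congr1 size); rewrite size_rcons.
rewrite dpath_rcons /= => /and3P[pt /eqP tz /eqP zu]; subst z.
case/lastP: t' => [/eqP ru|t' [j z]].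
  by move: tz; rewrite -ru => /(congr1 size); rewrite size_rcons.
rewrite dpath_rcons /= => /and3P[pt' /eqP tz' /eqP zu]; subst z.
(* Two decompositions of the trace of [u] give the same predecessor trace and action. *)
have /rcons_inj[eqt ->] := etrans (esym tz) tz'.
congr rcons; apply: IHt pt _.
by rewrite (trace_inj eqt).
Qed.

End Unravelling.

(** Every state gets its own tree, so that any witness of [Ex] is the tip of some root. *)
Definition unravel_forest M (d : nat) (a : M) : fin_lts sigma :=
  @FinLTS sigma
    (disj_union (fun j : 'I_#|M| => carrier (unravel d (enum_val j))))
    (Tagged (fun j : 'I_#|M| => dom (unravel d (enum_val j)))
            (point (unravel d (enum_val (enum_rank a))))).

Lemma unravel_forestP M d (a : M) : is_forest (unravel_forest d a).
Proof.
exists #|M|, (fun j => unravel d (enum_val j)), (enum_rank a); split.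
  by move=> j; apply: unravel_tree.
by exists id; split=> //; exists id.
Qed.

Lemma unravel_forest_hom M d (a : M) : homB (unravel_forest d a) (FinLTS a).
Proof.
apply/homBP; exists (fun u => tip (tagged u)); split=> //=.
  by rewrite /tip /= enum_rankK.
move=> i [j x] [l y] /= /andP[/eqP jl]; case: l / jl y => y.
by rewrite tagged_asE => /unravel_rel_tip.
Qed.

(** [Ex] costs nothing: its witness is taken at a fresh root, where the full depth [d] is available
    again. *)
Fixpoint modal_depth (phi : form) : nat :=
  match phi with
  | And f g | Or f g => maxn (modal_depth f) (modal_depth g)
  | Dia _ f => (modal_depth f).+1
  | Ex f => modal_depth f
  | _ => 0
  end.

Lemma sat_unravel_forest M N d (a : M) (b : N) phi :
  modal_depth phi <= d -> homB (unravel_forest d a) (FinLTS b) ->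
  sat a phi -> sat b phi.
Proof.
move=> phid /homBP[h [hp hv hr]].
pose node j (u : unravel d (enum_val j)) : unravel_forest d a :=
  Tagged (fun j : 'I_#|M| => dom (unravel d (enum_val j))) u.
(* The trace length plus the depth of [psi] stays within [d], so each diamond still finds a
   successor in the truncated tree. *)
have transfer psi j (u : unravel d (enum_val j)) :
    size (trace u) + modal_depth psi <= d -> sat (tip u) psi ->
    sat (h (node j u)) psi.
  elim: psi j u => [|p|f IHf g IHg|f IHf g IHg|i f IHf|f IHf] j u //=.
  - by move=> _ up; apply: hv.
  - rewrite addn_maxr geq_max => /andP[fd gd] [uf ug].
    by split; [apply: IHf|apply: IHg].
  - rewrite addn_maxr geq_max => /andP[fd gd] [uf|ug].
      by left; apply: IHf.
    by right; apply: IHg.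
  - rewrite addnS => fd [y [uy yf]].
    have [|v [uv vy sv]] := unravel_step _ uy.
      by apply: leq_trans fd; rewrite ltnS leq_addr.
    exists (h (node j v)); split; first by apply: hr; rewrite disj_union_rel.
    by apply: IHf; rewrite ?vy // sv addSn.
  - move=> fd [y yf]; exists (h (node (enum_rank y) (point (unravel d _)))).
    apply: IHf; first by apply: leq_trans fd; rewrite leq_add2r.
    by rewrite /tip /= /path_end /= enum_rankK.
move=> aphi; rewrite -[b]hp; apply: transfer => //.
by rewrite /tip /= /path_end /= enum_rankK.
Qed.

End Forests.

Theorem theorem3p7 (sigma : modal_signature) (Ma Nb : fin_lts sigma) :
  ml_equiv Ma Nb <-> homB_agree (@is_forest sigma) Ma Nb.
Proof.
case: Ma Nb => [M a] [N b]; split=> [equivMN T /forest_char_form[phi phiP]|agree phi].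
  by apply/idP/idP => /phiP/equivMN/phiP.
(* Stated for arbitrary structures to serve both directions. The forest is cut at the modal depth of
   [phi]; it maps to its source by tips, hence by agreement to the target. *)
have transfer (M' N' : fin_struct sigma) (x : M') (y : N') :
    homB_agree (@is_forest sigma) (FinLTS x) (FinLTS y) -> sat x phi -> sat y phi.
  move=> agree'; apply: (sat_unravel_forest (leqnn _)).
  by rewrite -agree' ?unravel_forest_hom //; apply: unravel_forestP.
by split; apply: transfer => // T /agree ->.
Qed.
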